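(* Let $X$ be a set, let $G$ be a topological subgroup of $\mathrm{Sym}(X)$, and let $\mathscr{A}$ be a $G$-attractive and $G$-invariant filter on $X$. Then the following hold: (1) If $G$ is $\mathscr{A}$-approximated by some $H \leq G$, then $G$ is proximally simulated by $H$. (2) If there exists an amenable topological group $H$ along with a balanced homomorphism $\psi \colon H \to G$ such that $G$ is $\mathscr{A}$-approximated by $\psi(H)$, then $G$ is skew-amenable. (3) If $G$ is $\mathscr{A}$-approximated by a discretely amenable subgroup, then $G$ is skew-amenable.
   Context: For a topological group $G$, let $\mathscr{U}(G)$ be the set of neighborhoods of the neutral element, and for $g\in G$ let $\lambda_g\colon G\to G,\ x\mapsto gx$. $\mathrm{LUCB}(G)$ is the algebra of bounded functions $f\colon G\to\mathbb{R}$ that are left-uniformly continuous, i.e., for every $\epsilon>0$ there is $U\in\mathscr{U}(G)$ with $|f(x)-f(y)|\le\epsilon$ whenever $x^{-1}y\in U$. $\mathrm{RUCB}(G)$ is defined in the same way with $xy^{-1}\in U$ in place of $x^{-1}y\in U$. A mean on one of these algebras is a positive linear functional $\mu$ with $\mu(\mathbf 1)=1$; it is left-invariant if $\mu(f\circ\lambda_g)=\mu(f)$ for all $f$ and all $g\in G$. $G$ is skew-amenable if $\mathrm{LUCB}(G)$ admits a left-invariant mean. $G$ is amenable if every continuous action of $G$ on a non-void compact Hausdorff space admits an invariant regular Borel probability measure (equivalently, $\mathrm{RUCB}(G)$ admits a left-invariant mean). A subgroup is discretely amenable if it is amenable as a discrete group. A homomorphism $\psi\colon H\to G$ of topological groups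 is balanced if $\bigcap_{g\in G}\psi^{-1}(g^{-1}Ug)\in\mathscr{U}(H)$ for every $U\in\mathscr{U}(G)$. A topological group $G$ is proximally simulated by a subgroup $H\leq G$ if for every finite $E\subseteq G$ there is a family $(h_g)_{g\in E}\in H^E$ such that for every $U\in\mathscr{U}(G)$ and every finite $S\subseteq G$ there is $t\in G$ with $gst\in h_gstU$ for all $g\in E$ and $s\in S$. $\mathrm{Sym}(X)$ is the group of all permutations of $X$ with the topology of pointwise convergence associated with the discrete topology on $X$; a topological subgroup carries the subspace topology. For $G\leq\mathrm{Sym}(X)$: - a subset $A\subseteq X$ is $G$-attractive if for every finite $F\subseteq X$ there is $g\in G$ with $g(F)\subseteq A$; a filter on $X$ is $G$-attractive if all its members are; - a filter $\mathscr{A}$ on $X$ is $G$-invariant if $g(A)\in\mathscr{A}$ for all $A\in\mathscr{A}$ and $g\in G$; - $G$ is $\mathscr{A}$-approximated by a subgroup $K\leq G$ if for every $g\in G$ there are $h\in K$ and $A\in\mathscr{A}$ with $g|_A=h|_A$. *)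

(* Defs.v *)
From HB Require Import structures.
From mathcomp Require Import all_boot all_order all_algebra.
From mathcomp Require Import all_classical all_reals all_analysis.
Import numFieldNormedType.Exports.

Set Implicit Arguments.
Unset Strict Implicit.
Unset Printing Implicit Defensive.

Local Open Scope classical_set_scope.
Local Open Scope group_scope.

HB.mixin Record isTopologicalGroup G of Group G & Topological G := {
  mulg_continuous : continuous (fun x : G * G => x.1 * x.2);
  invg_continuous : continuous (fun x : G => x^-1)
}.

#[short(type="topGroupType")]
HB.structure Definition TopologicalGroup :=
  {G of isTopologicalGroup G & Group G & Topological G}.

Section Discrete.
Variable G : groupType.

HB.instance Definition _ := Group.copy (discrete_topology G) G.

Lemma discrete_mul_continuous :
  continuous (fun x : discrete_topology G * discrete_topology G => x.1 * x.2).
Proof.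
move=> [a b]; apply/discrete_cvg => /=.
exists ([set a], [set b]); first by split; exact: discrete_set1.
by move=> [c d] /= [-> ->].
Qed.

Lemma discrete_inv_continuous : continuous (fun x : discrete_topology G => x^-1).
Proof.
move=> a; apply/discrete_cvg.
by apply: (@filterS _ (nbhs a) _ [set a]) => [c ->//|]; exact: discrete_set1.
Qed.

HB.instance Definition _ := isTopologicalGroup.Build (discrete_topology G)
  discrete_mul_continuous discrete_inv_continuous.

End Discrete.

Record subgroup (G : groupType) := Subgroup {
  subgroup_set :> set G;
  subgroup1 : subgroup_set 1;
  subgroupM : forall x y, subgroup_set x -> subgroup_set y ->
    subgroup_set (x * y);
  subgroupV : forall x, subgroup_set x -> subgroup_set x^-1
}.

Definition subgroup_mem (G : groupType) (S : subgroup G) (x : G) : Prop :=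
  subgroup_set S x.
Coercion subgroup_mem : subgroup >-> Funclass.

Section SubgroupGroup.
Variables (G : groupType) (S : subgroup G).

Lemma subgroup_group_closed : group_closed (fun x => x \in (S : set G)).
Proof.
split=> [|x y]; rewrite !unfold_in; first exact/mem_set/subgroup1.
by move=> /set_mem Sx /set_mem Sy; exact/mem_set/subgroupM/subgroupV.
Qed.

HB.instance Definition _ := SubChoice.copy (set_type S)
  {x : G | x \in (S : set G)}.
HB.instance Definition _ := SubChoice_isSubGroup.Build G
  (fun x => x \in (S : set G)) (set_type S) subgroup_group_closed.

End SubgroupGroup.

Section SubgroupTopologicalGroup.
Variables (G : topGroupType) (S : subgroup G).

Lemma subgroup_mul_continuous :
  continuous (fun x : set_type S * set_type S => x.1 * x.2).
Proof.
apply: (@continuous_comp_initial _ _ _ (set_val : set_type S -> G)) => x.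
have -> : set_val \o (fun y : set_type S * set_type S => y.1 * y.2) =
  (fun y : G * G => y.1 * y.2) \o (fun y => (set_val y.1, set_val y.2)) by [].
apply: continuous_comp; last exact: mulg_continuous.
apply: cvg_pair.
  by apply: continuous_comp; [exact: cvg_fst | exact: initial_continuous].
by apply: continuous_comp; [exact: cvg_snd | exact: initial_continuous].
Qed.

Lemma subgroup_inv_continuous : continuous (fun x : set_type S => x^-1).
Proof.
apply: (@continuous_comp_initial _ _ _ (set_val : set_type S -> G)) => x.
have -> : set_val \o (fun y : set_type S => y^-1) =
  (fun y : G => y^-1) \o set_val by [].
apply: continuous_comp; last exact: invg_continuous.
exact: initial_continuous.
Qed.

HB.instance Definition _ := isTopologicalGroup.Build (set_type S)
  subgroup_mul_continuous subgroup_inv_continuous.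

End SubgroupTopologicalGroup.

Record Sym (X : Type) := MkSym {
  sym_fun :> X -> X;
  sym_bij : bijective sym_fun
}.

Section SymGroup.
Variable X : Type.
Implicit Types s t u : Sym X.

Lemma sym_ext s t : s =1 t -> s = t.
Proof.
case: s t => [f bf] [g bg] /= /funext fg.
by rewrite fg in bf *; rewrite (Prop_irrelevance bf bg).
Qed.

HB.instance Definition _ := gen_eqMixin (Sym X).
HB.instance Definition _ := gen_choiceMixin (Sym X).

Lemma sym_inv_exists s : exists t, cancel s t /\ cancel t s.
Proof. by have [g fK gK] := sym_bij s; exists (MkSym (Bijective gK fK)). Qed.

Definition sym_one : Sym X := MkSym (@inv_bij X id (fun=> erefl)).
Definition sym_mul s t : Sym X := MkSym (bij_comp (sym_bij s) (sym_bij t)).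
Definition sym_inv s : Sym X := sval (cid (sym_inv_exists s)).

Lemma symK s : cancel s (sym_inv s).
Proof. by rewrite /sym_inv; case: cid => t []. Qed.

Lemma symVK s : cancel (sym_inv s) s.
Proof. by rewrite /sym_inv; case: cid => t []. Qed.

Lemma sym_mulA : associative sym_mul.
Proof. by move=> s t u; exact: sym_ext. Qed.
Lemma sym_mul1 : left_id sym_one sym_mul.
Proof. by move=> s; exact: sym_ext. Qed.
Lemma sym_mul1r : right_id sym_one sym_mul.
Proof. by move=> s; exact: sym_ext. Qed.
Lemma sym_mulV : left_inverse sym_one sym_inv sym_mul.
Proof. by move=> s; apply: sym_ext => x /=; rewrite symK. Qed.
Lemma sym_mulVr : right_inverse sym_one sym_inv sym_mul.
Proof. by move=> s; apply: sym_ext => x /=; rewrite symVK. Qed.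

HB.instance Definition _ := isGroup.Build (Sym X)
  sym_mulA sym_mul1 sym_mul1r sym_mulV sym_mulVr.

Definition sym_ptws s : {ptws X -> discrete_topology {classic X}} := s.

HB.instance Definition _ :=
  Topological.copy (Sym X) (initial_topology sym_ptws).

Lemma sym_nbhs s x : nbhs s (fun t : Sym X => t x = s x).
Proof.
have xs : nbhs (sym_ptws s) [set f | f x = s x].
  have xs : nbhs (sym_ptws s x) [set s x].
    exact: (@discrete_set1 (discrete_topology {classic X})).
  exact: (@proj_continuous {classic X}
    (fun=> discrete_topology {classic X}) x (sym_ptws s) _ xs).
exact: (@initial_continuous (Sym X) _ sym_ptws s _ xs).
Qed.

Lemma sym_continuous (Y : topologicalType) (f : Y -> Sym X) :
  (forall y x, nbhs y (fun z => f z x = f y x)) -> continuous f.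
Proof.
move=> fP; apply: (@continuous_comp_initial _ _ _ sym_ptws) => y.
apply/cvg_sup => x U [_ [[W _ <-] Wy] WU]; rewrite /= in Wy WU.
by apply: filterS (fP y x) => z fz; apply: WU; rewrite /= /sym_ptws fz.
Qed.

Lemma sym_mul_continuous : continuous (fun p : Sym X * Sym X => p.1 * p.2).
Proof.
apply: sym_continuous => -[s t] x /=.
exists ([set s' : Sym X | s' (t x) = s (t x)], [set t' : Sym X | t' x = t x]).
  by split; exact: sym_nbhs.
by move=> [s' t'] /= [es et]; rewrite et es.
Qed.

Lemma sym_inv_continuous : continuous (fun s : Sym X => s^-1).
Proof.
apply: sym_continuous => s x; have := sym_nbhs s (sym_inv s x).
apply: filterS => t; rewrite symVK => e.
by apply: (bij_inj (sym_bij t)); rewrite e; exact: symVK.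
Qed.

HB.instance Definition _ := isTopologicalGroup.Build (Sym X)
  sym_mul_continuous sym_inv_continuous.

End SymGroup.

Section ImageSubgroup.
Variables (H G : groupType) (psi : {multiplicative H -> G}).

Lemma hom1 : psi 1 = 1.
Proof. by apply: (mulgI (psi 1)); rewrite -gmulfM !mulg1. Qed.

Lemma hom_imageM x y : range psi x -> range psi y -> range psi (x * y).
Proof. by move=> [a _ <-] [b _ <-]; exists (a * b) => //; exact: gmulfM. Qed.

Lemma hom_imageV x : range psi x -> range psi x^-1.
Proof.
move=> [a _ <-]; exists a^-1 => //.
by apply: (mulgI (psi a)); rewrite -gmulfM !mulgV hom1.
Qed.

Definition hom_image : subgroup G :=
  @Subgroup G (range psi) (ex_intro2 _ _ 1 I hom1) hom_imageM hom_imageV.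

End ImageSubgroup.

Section SkewAmenability.
Variables (R : realType) (G : topGroupType).
Local Open Scope ring_scope.

Definition LUCB : set (G -> R) := [set f | bounded_fun f /\
  forall eps : R, 0 < eps -> exists2 U : set G, nbhs (1%g : G) U &
    forall x y : G, U (x^-1 * y)%g -> `|f x - f y| <= eps].

(* Only the values of m on the algebra A are constrained, so m stands for a
   functional A -> R. *)
Definition is_mean (A : set (G -> R)) (m : (G -> R) -> R) : Prop :=
  [/\ forall (a : R) (f g : G -> R), A f -> A g ->
        m (fun x => a * f x + g x) = a * m f + m g,
      forall f : G -> R, A f -> (forall x, 0 <= f x) -> 0 <= m f &
      m (fun=> 1) = 1].

Definition left_invariant (A : set (G -> R)) (m : (G -> R) -> R) : Prop :=
  forall (f : G -> R) (g : G), A f -> m (fun x => f (g * x)%g) = m f.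

Definition skew_amenable : Prop :=
  exists m, is_mean LUCB m /\ left_invariant LUCB m.

End SkewAmenability.

Definition borelType (K : ptopologicalType) := g_sigma_algebraType (@open K).

Definition regular_measure (R : realType) (K : ptopologicalType)
    (mu : probability (borelType K) R) : Prop :=
  forall B : set (borelType K), measurable B ->
    mu B = ereal_sup [set mu C | C in [set C : set K | compact C /\ C `<=` B]]
    /\ mu B = ereal_inf [set mu U | U in [set U : set K | open U /\ B `<=` U]].

Record continuous_action (G : topGroupType) (K : topologicalType) := Action {
  act :> G -> K -> K;
  act1 : forall x, act 1 x = x;
  actM : forall g h x, act (g * h) x = act g (act h x);
  act_continuous : continuous (fun p : G * K => act p.1 p.2)
}.

(* A pointed topological space is a non-void one. *)
Definition amenable (R : realType) (G : topGroupType) : Prop :=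
  forall (K : ptopologicalType) (alpha : continuous_action G K),
    compact [set: K] -> hausdorff_space K ->
    exists mu : probability (borelType K) R, regular_measure mu /\
      forall (g : G) (B : set (borelType K)), measurable B ->
        mu (alpha g @^-1` B) = mu B.

Definition discretely_amenable (R : realType) (G : groupType) : Prop :=
  amenable R (discrete_topology G).

(* Taking g = 1 shows that a balanced homomorphism is continuous. *)
Definition balanced (H G : topGroupType) (psi : {multiplicative H -> G}) :=
  forall U : set G, nbhs (1 : G) U ->
    nbhs (1 : H) (\bigcap_(g in [set: G]) psi @^-1` [set u ^ g | u in U]).

Definition proximally_simulated (G : topGroupType) (H : subgroup G) : Prop :=
  forall E : set G, finite_set E ->
  exists2 h : G -> G, (forall g, E g -> H (h g)) &
    forall (U : set G) (S : set G), nbhs (1 : G) U -> finite_set S ->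
    exists t : G, forall g s, E g -> S s ->
      [set h g * s * t * u | u in U] (g * s * t).

Section PermutationGroups.
Variables (X : Type) (G : subgroup (Sym X)).

Definition attractive (A : set X) : Prop :=
  forall F : set X, finite_set F -> exists2 g : Sym X, G g & g @` F `<=` A.

Definition attractive_filter (A : set_system X) : Prop :=
  forall B, A B -> attractive B.

Definition invariant_filter (A : set_system X) : Prop :=
  forall (B : set X) (g : Sym X), A B -> G g -> A (g @` B).

Definition approximated (A : set_system X) (K : subgroup G) : Prop :=
  forall g : G, exists2 h : G, K h &
    exists2 B : set X, A B & forall x, B x -> set_val g x = set_val h x.

End PermutationGroups.

(* Main.v *)
From HB Require Import structures.
Require Import Defs.
From mathcomp Require Import all_boot all_order all_algebra.
From mathcomp Require Import all_classical all_reals all_analysis.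
From mathcomp Require Import measurable_realfun.
Import numFieldNormedType.Exports.
Import Order.TTheory GRing.Theory Num.Theory.

Set Implicit Arguments.
Unset Strict Implicit.
Unset Printing Implicit Defensive.

Local Open Scope classical_set_scope.
Local Open Scope group_scope.

(** The proof rests on one filter on [G]. By attractivity, the sets
    [{t | t(F) <= B}], for [F] finite and [B] in [A], generate a proper filter
    [attracted]. If [g] and [h] agree on a member of [A] then, by invariance of
    [A], for each fixed [s] and along this filter the points of a given finite
    set are eventually sent by [s t] to where [g] and [h] agree; so [g s t] is
    eventually in [h s t U], for every neighborhood [U] of the identity
    ([attracted_simulation]). Finitely many such conditions hold together for
    some [t], which is (1).

    For (2), fix an ultrafilter [tau] finer than [attracted] and send a left
    uniformly continuous bounded [f] on [G] to the function
      [Phi f : h |-> lim_(t -> tau) f (psi h * t)]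
    on [H]. The quotients [(psi y * t)^-1 * (psi x * t)] are conjugates of
    [psi (x * y^-1)], so balancedness makes the functions [x |-> f (psi x * t)],
    for [t] in [G], right uniformly equicontinuous, and [Phi f] is right
    uniformly continuous ([right_limit_RUCB]). If [g] agrees with [psi k] on a
    member of [A], then [f (g * psi h * t)] and [f (psi k * psi h * t)] have
    the same limit, so [Phi] turns the left translation of [f] by [g] into the
    left translation of [Phi f] by [k]. Composing [Phi] with a left-invariant
    mean [nu] of [RUCB H] therefore gives a left-invariant mean of [LUCB G].
    The limit in [t] has to be taken before averaging over [H]: the simulation
    holds eventually in [t] for each fixed [h], not uniformly in [h].

    The mean [nu] comes from amenability, stated through actions on compact
    spaces: [H] acts continuously on the compact Hausdorff space of all means
    of [RUCB H], and the barycentre of an invariant probability measure is a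
    left-invariant mean ([amenable_RUCB_mean]). Statement (3) is (2) for the
    inclusion of the subgroup with its discrete topology, which is balanced
    because every set containing the identity is a neighborhood. *)

(** * Bounded functions and limits along ultrafilters *)

Section UltrafilterLimits.
Variables (R : realType) (T : Type).
Local Open Scope ring_scope.
Implicit Types f g : T -> R.

Lemma bounded_funP f : bounded_fun f <-> exists C, forall x, `|f x| <= C.
Proof.
split=> [[M [_ fM]]|[C fC]].
  by exists (M + 1) => x; apply: fM => //; rewrite ltrDl.
exists C; split; [exact: num_real | move=> M /ltW CM x _].
exact: le_trans (fC x) CM.
Qed.

Lemma bounded_fun_linear a f g :
  bounded_fun f -> bounded_fun g -> bounded_fun (fun x => a * f x + g x).
Proof.
move=> /bounded_funP[C fC] /bounded_funP[D gD]; apply/bounded_funP.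
exists (`|a| * C + D) => x; apply: le_trans (ler_normD _ _) _.
by rewrite normrM lerD// ler_wpM2l.
Qed.

(** A cluster point of the image filter exists by compactness of [-C, C]; an
    ultrafilter decides every preimage, so it converges there. *)
Lemma ultra_cvg_lim (F : set_system T) f : UltraFilter F -> bounded_fun f ->
  f @ F --> lim (f @ F).
Proof.
move=> FU /bounded_funP[C fC]; have FP := @ultra_proper _ _ FU.
have Ff : (f @ F) `[- C, C]%classic.
  apply: (@filterS _ F _ setT) filterT => x _.
  by rewrite /= in_itv/= -ler_norml.
have [p [_ pf]] := @segment_compact R (- C) C (f @ F) _ Ff.
apply/cvg_ex; exists p => U pU.
have [//|FnU] := in_ultra_setVsetC (f @^-1` U) FU.
by have [y []] := pf (~` U) U FnU pU.
Qed.

End UltrafilterLimits.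

Lemma bounded_fun_comp (R : realType) (S T : Type) (u : S -> T) (f : T -> R) :
  bounded_fun f -> bounded_fun (f \o u).
Proof.
by move=> /bounded_funP[C fC]; apply/bounded_funP; exists C => x; exact: fC.
Qed.

(** * Approximation along an attractive filter *)

Section PermutationTopology.
Variables (X : Type) (G : subgroup (Sym X)).

Lemma subgroup_sym_cvg (F : set_system (set_type G)) (g : set_type G) :
  Filter F -> (forall x, F (fun t => set_val t x = set_val g x)) -> F --> g.
Proof.
move=> FF Fx.
suff Fg : (fun t : set_type G => sym_ptws (set_val t)) @ F -->
    sym_ptws (set_val g).
  move=> U; rewrite nbhsE => -[V [[P [Q Qo <-] PV] Vg] VU].
  apply: (filterS VU); rewrite -PV; apply: (Fg Q).
  by apply: open_nbhs_nbhs; split => //; move: Vg; rewrite -PV.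
apply/cvg_sup => x U [_ [[W _ <-] Wy] WU]; rewrite /= in Wy WU.
apply: (@filterS _ F _ _
  ((fun t : set_type G => sym_ptws (set_val t)) @^-1` U)) (Fx x).
by move=> t tx; apply: WU; rewrite /= /sym_ptws tx.
Qed.

(** The sets containing a pointwise stabilizer of a finite set form a filter,
    and this filter converges to the identity pointwise; hence it contains all
    neighborhoods of the identity. *)
Lemma nbhs1_fixator (U : set (set_type G)) : nbhs (1 : set_type G) U ->
  exists2 F : set X, finite_set F &
    forall t : set_type G, (forall x, F x -> set_val t x = x) -> U t.
Proof.
pose B : set_system (set_type G) := [set U | exists2 F : set X, finite_set F &
    forall t : set_type G, (forall x, F x -> set_val t x = x) -> U t].
suff : B --> (1 : set_type G) by apply.
have FB : Filter B.
  split=> [|P Q [E fE EP] [F fF FQ]|P Q PQ [E fE EP]].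
  - by exists set0.
  - exists (E `|` F); first by rewrite finite_setU.
    by move=> t tEF; split; [apply: EP | apply: FQ] => x ?; apply: tEF;
      [left | right].
  - by exists E => // t /EP /PQ.
apply: subgroup_sym_cvg => x; exists [set x] => // t tx.
by rewrite tx.
Qed.

End PermutationTopology.

Section Attraction.
Variables (X : Type) (G : subgroup (Sym X)) (A : set_system X).
Hypotheses (filterA : Filter A) (attractA : attractive_filter G A)
  (invA : invariant_filter G A).

(** Read [t --> attracted] as: [t] pushes all finite sets into all members of
    [A]. *)
Definition attracted : set_system (set_type G) :=
  [set P | exists F : set X, exists2 B, finite_set F /\ A B &
    forall t : set_type G, set_val t @` F `<=` B -> P t].

Lemma attracted_proper : ProperFilter attracted.
Proof.
split.
  move=> [F [B [fF AB] FB]].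
  have [g Gg gF] := attractA AB fF.
  exact: (FB (exist _ g (mem_set Gg))).
split=> [|P Q [E [B [fE AB] EP]] [F [C [fF AC] FQ]]|P Q PQ [E [B EB EP]]].
- by exists set0, setT => //; split => //; exact: filterT.
- exists (E `|` F), (B `&` C).
    by split; [rewrite finite_setU | exact: filterI].
  move=> t tEF; split; [apply: EP | apply: FQ] => _ [x Fx <-].
    by have [] := tEF (set_val t x) (ex_intro2 _ _ x (or_introl Fx) erefl).
  by have [] := tEF (set_val t x) (ex_intro2 _ _ x (or_intror Fx) erefl).
- by exists E, B => // t /EP /PQ.
Qed.

(** Membership of [(h * s * t)^-1 * (g * s * t)] in [U] only asks [g] and [h] to
    agree at the points [s (t x)], for [x] in a finite set, so it suffices that
    [t] moves this set into [s^-1(B)], which is in [A] by invariance. *)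
Lemma attracted_simulation (g h : set_type G) (B : set X) : A B ->
  (forall x, B x -> set_val g x = set_val h x) ->
  forall (s : set_type G) (U : set (set_type G)), nbhs (1 : set_type G) U ->
    attracted [set t | U ((h * s * t)^-1 * (g * s * t))].
Proof.
move=> AB gh s U /nbhs1_fixator[F fF FU].
exists F, (set_val s^-1 @` B).
  by split => //; apply: invA => //; apply/set_mem/valP.
move=> t tF; apply: FU => x Fx.
have [y By ys] : (set_val s^-1 @` B) (set_val t x) by apply: tF; exists x.
have e : set_val (g * s * t) x = set_val (h * s * t) x.
  have /= sy : set_val s (set_val t x) = y by rewrite -ys /=; exact: symVK.
  by rewrite /= !sy; exact: gh.
rewrite /= in e *; rewrite e.
exact: symK.
Qed.

End Attraction.

Arguments attracted {X} G A _.

Lemma approximated_proximally_simulated (X : Type) (G : subgroup (Sym X))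
    (A : set_system X) (H : subgroup G) : Filter A ->
  attractive_filter G A -> invariant_filter G A -> approximated A H ->
  proximally_simulated H.
Proof.
move=> fA attA invA apprA.
have /choice[h hP] : forall g : set_type G, exists h, H h /\
    exists2 B, A B & forall x, B x -> set_val g x = set_val h x.
  by move=> g; have [h] := apprA g; exists h.
move=> E fE; exists h => [g _|U S U1 fS].
  by have [] := hP g.
have AP := attracted_proper fA attA.
have near (g s : set_type G) :
    attracted G A [set t | U ((h g * s * t)^-1 * (g * s * t))].
  by have [_ [B AB gh]] := hP g; exact: attracted_simulation AB gh s U U1.
have [t tP] : exists t, forall p, (E `*` S) p ->
    U ((h p.1 * p.2 * t)^-1 * (p.1 * p.2 * t)).
  have /finite_fsetP[D ED] := finite_setX fE fS.
  apply: (@filter_ex _ (attracted G A)).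
  have := @filter_bigI _ _ D (fun p : set_type G * set_type G =>
    [set t | U ((h p.1 * p.2 * t)^-1 * (p.1 * p.2 * t))]) (attracted G A) _
    (fun p _ => near p.1 p.2).
  move=> /(_ _)/filterS; apply=> t tD p EpS; apply: tD.
  by move: EpS; rewrite ED.
exists t => g s Eg Ss; exists ((h g * s * t)^-1 * (g * s * t)).
  exact: (tP (g, s)).
by rewrite mulVKg.
Qed.

(** * Means on right uniformly continuous functions *)

Section RightUniform.
Variables (R : realType) (H : topGroupType).
Local Open Scope ring_scope.

Definition RUCB : set (H -> R) := [set f | bounded_fun f /\
  forall eps : R, 0 < eps -> exists2 U : set H, nbhs (1%g : H) U &
    forall x y : H, U (x * y^-1)%g -> `|f x - f y| <= eps].

Lemma RUCB_cst (c : R) : RUCB (fun=> c).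
Proof.
split; first by apply/bounded_funP; exists `|c|.
move=> e e0; exists setT; first exact: filterT.
by move=> x y _; rewrite subrr normr0 ltW.
Qed.

Lemma RUCB_linear (a : R) (f g : H -> R) :
  RUCB f -> RUCB g -> RUCB (fun x => a * f x + g x).
Proof.
move=> [bf uf] [bg ug]; split; first exact: bounded_fun_linear.
move=> e e0; have a1 : 0 < `|a| + 1 by rewrite ltr_wpDl.
have [|U U1 fU] := uf (e / 2 / (`|a| + 1)); first by rewrite !divr_gt0.
have [|V V1 gV] := ug (e / 2); first by rewrite divr_gt0.
exists (U `&` V); first exact: filterI.
move=> x y [/fU fxy /gV gxy].
rewrite opprD addrACA -mulrBr [leRHS]splitr.
apply: le_trans (ler_normD _ _) _; rewrite lerD// normrM.
apply: (@le_trans _ _ ((`|a| + 1) * `|f x - f y|)).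
  by rewrite ler_wpM2r// lerDl.
by rewrite mulrC -ler_pdivlMr.
Qed.

Lemma mulg_cvg (a b : H) :
  (fun x => (a * x * b)%g) @ nbhs (1 : H)%g --> (a * b)%g.
Proof.
have c1 : continuous (fun x : H => (a * x)%g).
  move=> x; apply: (@continuous_comp _ _ _ (fun x => (a, x))
    (fun p : H * H => (p.1 * p.2)%g)).
    by apply: cvg_pair; [exact: cvg_cst | exact: cvg_id].
  exact: mulg_continuous.
have c2 : continuous (fun x : H => (x * b)%g).
  move=> x; apply: (@continuous_comp _ _ _ (fun x => (x, b))
    (fun p : H * H => (p.1 * p.2)%g)).
    by apply: cvg_pair; [exact: cvg_id | exact: cvg_cst].
  exact: mulg_continuous.
rewrite -[X in (X * b)%g](mulg1 a).
exact: (continuous_comp (c1 1%g) (c2 _)).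
Qed.

Lemma RUCB_translate (h : H) (f : H -> R) :
  RUCB f -> RUCB (fun x => f (h * x)%g).
Proof.
move=> [bf uf]; split; first exact: (bounded_fun_comp (fun x => (h * x)%g) bf).
move=> e /uf[U U1 fU]; exists [set x | U (h * x * h^-1)%g].
  by apply: mulg_cvg; rewrite mulgV.
by move=> x y Uxy; apply: fU; rewrite invgM mulgA -[(h * x * _)%g]mulgA.
Qed.

Lemma RUCB_translateV (h : H) (f : H -> R) :
  RUCB (fun x => f (h * x)%g) -> RUCB f.
Proof.
move=> /(RUCB_translate h^-1%g); congr RUCB; apply/funext => x.
by rewrite mulVKg.
Qed.

(** Means are 1-Lipschitz for the supremum norm; this gives both the bounds
    behind compactness and the joint continuity of the action. *)
Lemma mean_dist (m : (H -> R) -> R) (f g : H -> R) (C : R) :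
  is_mean RUCB m -> RUCB f -> RUCB g -> (forall x, `|f x - g x| <= C) ->
  `|m f - m g| <= C.
Proof.
move=> [mL m0 m1] Af Ag fgC.
have mean_le u v : RUCB u -> RUCB v -> (forall x, u x <= v x) -> m u <= m v.
  move=> Au Av uv.
  rewrite -subr_ge0 addrC -mulN1r -mL//; apply: m0 => [|x].
    exact: RUCB_linear.
  by rewrite mulN1r addrC subr_ge0.
have mC u : RUCB u -> m (fun x => C * 1 + u x) = C + m u.
  by move=> Au; rewrite mL ?m1 ?mulr1//; exact: RUCB_cst.
have AC u : RUCB u -> RUCB (fun x => C * 1 + u x).
  by move=> Au; apply: RUCB_linear => //; exact: RUCB_cst.
rewrite ler_distl lerBlDl -!mC //; apply/andP; split.
  apply: mean_le => //; first exact: AC.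
  by move=> x; move: (fgC x); rewrite mulr1 ler_distl lerBlDl => /andP[].
rewrite [leRHS]addrC -mC//; apply: mean_le => //; first exact: AC.
by move=> x; move: (fgC x); rewrite mulr1 ler_distl [C + _]addrC => /andP[].
Qed.

(** Requiring the value 0 outside [RUCB] makes such a map determined by its
    restriction to [RUCB], so that pointwise convergence on [RUCB] is
    separated. *)
Definition means : set {ptws (H -> R) -> R} :=
  [set m | is_mean RUCB m /\ forall f, ~ RUCB f -> m f = 0].

Definition meanSpace := set_type means.
HB.instance Definition _ := Topological.on meanSpace.

Definition mean_eval (k : meanSpace) : (H -> R) -> R := set_val k.

Lemma mean_evalP k : is_mean RUCB (mean_eval k).
Proof. by have /set_mem[] := valP k. Qed.

Lemma mean_eval0 k f : ~ RUCB f -> mean_eval k f = 0.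
Proof. by have /set_mem[_ +] := valP k; exact. Qed.

Lemma dirac_means : means (fun f => if `[< RUCB f >] then f 1%g else 0).
Proof.
split; last by move=> f /asboolPn/negbTE ->.
split=> [a f g fA gA|f fA f0|].
- by rewrite !asboolT//; exact: RUCB_linear.
- by rewrite asboolT.
- by rewrite asboolT//; exact: RUCB_cst.
Qed.

Definition dirac_mean : meanSpace :=
  exist (fun m => m \in means) _ (mem_set dirac_means).

HB.instance Definition _ := isPointed.Build meanSpace dirac_mean.

Lemma meanSpace_cvg (T : Type) (F : set_system T) (u : T -> meanSpace) k :
  Filter F ->
  (forall f, RUCB f -> mean_eval (u x) f @[x --> F] --> mean_eval k f) ->
  u @ F --> k.
Proof.
move=> FF uk.
suff Fg : (fun x => (set_val (u x) : {ptws (H -> R) -> R})) @ F -->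
    (set_val k : {ptws (H -> R) -> R}).
  move=> U; rewrite nbhsE => -[V [[P Po PV] Vg] VU].
  apply: (filterS VU); rewrite -PV.
  have FP : nbhs (set_val k : {ptws (H -> R) -> R}) P.
    by apply: open_nbhs_nbhs; split => //; move: Vg; rewrite -PV.
  exact: Fg FP.
apply/cvg_sup => f U [_ [[W Wo <-] Wy] WU]; rewrite /= in Wy WU.
have : (mean_eval (u x) f @[x --> F]) W.
  have [Af|nAf] := pselect (RUCB f).
    by apply: uk => //; exact: open_nbhs_nbhs.
  apply: (@filterS _ F _ setT) filterT => x _ /=.
  have -> : mean_eval (u x) f = mean_eval k f by rewrite !mean_eval0.
  exact: Wy.
by apply: (@filterS _ F) => x Wx; exact: WU.
Qed.

Lemma mean_eval_continuous f : continuous (mean_eval^~ f).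
Proof.
move=> k.
have c1 : continuous (fun m : {ptws (H -> R) -> R} => m f).
  exact: (@proj_continuous {classic (H -> R)} (fun=> R) f).
exact: (@continuous_comp _ _ _ (set_val : meanSpace -> {ptws (H -> R) -> R}) _ k
  (@initial_continuous _ _ _ k) (c1 _)).
Qed.

Lemma meanSpace_hausdorff : hausdorff_space meanSpace.
Proof.
move=> k l kl; apply/val_inj/funext => f.
apply: (@norm_hausdorff _ R^o) => U V Uk Vl.
have [z [Uz Vz]] := kl _ _ (mean_eval_continuous (f := f) Uk)
   (mean_eval_continuous (f := f) Vl).
by exists (mean_eval z f).
Qed.

End RightUniform.

(** * The action on the space of means *)

Section MeanAction.
Variables (R : realType) (H : topGroupType).
Local Open Scope ring_scope.
Local Notation K := (meanSpace R H).

Lemma mean_eval_bounded (f : H -> R) : bounded_fun ((@mean_eval R H)^~ f).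
Proof.
apply/bounded_funP; have [Af|nAf] := pselect (RUCB f); last first.
  by exists 0 => k; rewrite mean_eval0// normr0.
have [/bounded_funP[C fC] _] := Af.
have A0 := RUCB_cst H (0 : R).
exists C => k; have [mL _ _] := mean_evalP k.
have z0 : mean_eval k (fun=> 0) = 0.
  have := mL (-1) (fun=> 0) (fun=> 0) A0 A0.
  by rewrite mulr0 addr0 mulN1r addNr.
rewrite -[mean_eval k f]subr0 -z0; apply: mean_dist (mean_evalP k) _ _ _ => //.
by move=> x; rewrite subr0.
Qed.

(** The limit of an ultrafilter of means is taken function by function; each of
    the defining conditions of a mean passes to the limit. *)
Lemma meanSpace_compact : compact [set: K].
Proof.
rewrite compact_ultra => F FU _; have FP := @ultra_proper _ _ FU.
pose L f := lim (mean_eval k f @[k --> F]).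
have FL f : mean_eval k f @[k --> F] --> L f.
  exact: (ultra_cvg_lim FU (mean_eval_bounded f)).
have LP : means L.
  split; last first.
    move=> f nAf; rewrite /L; under eq_fun do rewrite mean_eval0//.
    exact: lim_cst.
  split=> [a f g Af Ag|f Af f0|].
  - have e : (fun k => mean_eval k (fun x => a * f x + g x)) =
        (fun k => a * mean_eval k f + mean_eval k g).
      by apply/funext => k; have [mL _ _] := mean_evalP k; rewrite mL.
    rewrite /L e.
    apply: cvg_lim => //; apply: cvgD; last exact: FL.
    by apply: cvgMr; exact: FL.
  - apply: limr_ge; first exact: cvgP (FL f).
    by apply: filterE => k; have [_ mp _] := mean_evalP k; exact: mp.
  - rewrite /L.
    under eq_fun do rewrite (let: And3 _ _ m1 := mean_evalP _ in m1).
    exact: lim_cst.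
exists (exist (fun m => m \in @means R H) L (mem_set LP)); split => //.
by apply: (@meanSpace_cvg _ _ _ _ id) => f _; exact: FL.
Qed.

Definition mean_translate (h : H) (m : (H -> R) -> R) : (H -> R) -> R :=
  fun f => m (fun x => f (h * x)%g).

Lemma mean_translate_means (h : H) (k : K) :
  means (mean_translate h (mean_eval k)).
Proof.
have [mL mp m1] := mean_evalP k; split; last first.
  by move=> f nAf; apply: mean_eval0 => /RUCB_translateV.
split=> [a f g Af Ag|f Af f0|].
- by apply: mL; exact: RUCB_translate.
- by apply: mp => //; exact: RUCB_translate.
- exact: m1.
Qed.

Definition mean_act (h : H) (k : K) : K :=
  exist (fun m => m \in @means R H) _ (mem_set (mean_translate_means h k)).

Lemma mean_act1 k : mean_act 1%g k = k.
Proof.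
apply/val_inj/funext => f /=; congr (mean_eval k); apply/funext => x.
by rewrite mul1g.
Qed.

Lemma mean_actM g h k : mean_act (g * h)%g k = mean_act g (mean_act h k).
Proof.
apply/val_inj/funext => f /=; congr (mean_eval k); apply/funext => x.
by rewrite mulgA.
Qed.

(** Near [(h, k)] the difference of the values at [f] splits into the effect of
    moving [h], small uniformly over all means because [f] is right uniformly
    continuous, and that of moving [k] with the test function [f (h * _)]
    fixed. *)
Lemma mean_act_continuous : continuous (fun p : H * K => mean_act p.1 p.2).
Proof.
move=> [h k]; apply: meanSpace_cvg => f Af /=.
apply/cvgrPdist_le => e e0.
have [_ /(_ (e / 2))[|U U1 fU]] := Af; first by rewrite divr_gt0.
have Uh : nbhs h [set h' | U (h * h'^-1)%g].
  have c : (fun x : H => (h * x^-1)%g) @ h --> (h * h^-1)%g.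
    apply: (@continuous_comp _ _ _ (fun x => (h, x^-1)%g)
      (fun p : H * H => (p.1 * p.2)%g)).
      by apply: cvg_pair; [exact: cvg_cst | exact: invg_continuous].
    exact: mulg_continuous.
  by apply: c; rewrite mulgV.
have /cvgrPdist_le/(_ (e / 2)) kf :=
  @mean_eval_continuous R H (fun x => f (h * x)%g) k.
have {}kf := kf (divr_gt0 e0 (ltr0n _ 2)).
exists ([set h' | U (h * h'^-1)%g],
  [set k' | `|mean_eval k (fun x => f (h * x)%g)
              - mean_eval k' (fun x => f (h * x)%g)| <= e / 2]); first by split.
move=> [h' k'] /= [Uh' kk'].
rewrite [leRHS]splitr.
apply: le_trans (ler_distD (mean_eval k' (fun x => f (h * x)%g)) _ _) _.
apply: lerD => //.
apply: mean_dist (mean_evalP k') _ _ _; try exact: RUCB_translate.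
by move=> x; apply: fU; rewrite invgM mulgA -[(h * x * _)%g]mulgA mulgV mulg1.
Qed.

Lemma mean_act_continuousr h : continuous (mean_act h).
Proof.
move=> k; apply: (@meanSpace_cvg _ _ _ (nbhs k)) => f _.
exact: (@mean_eval_continuous R H (fun x => f (h * x)%g) k).
Qed.

Definition mean_action : continuous_action H K :=
  Action mean_act1 mean_actM mean_act_continuous.

End MeanAction.

(** * Invariant means from invariant measures *)

Section BorelIntegral.
Variables (R : realType) (T : ptopologicalType).
Variable mu : probability (borelType T) R.
Local Open Scope ring_scope.

Lemma continuous_borel_measurable (f : T -> R) :
  continuous f -> measurable_fun setT (f : borelType T -> R).
Proof.
move=> cf; apply: (measurability _ (RGenOInfty.measurableE R)).
move=> _ [_ [a ->] <-]; rewrite setTI; apply: sub_sigma_algebra.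
by move/continuousP: cf; apply; exact: rray_open.
Qed.

Lemma continuous_borel_integrable (f : T -> R) :
  continuous f -> bounded_fun f ->
  mu.-integrable setT (EFin \o (f : borelType T -> R)).
Proof.
move=> cf bf; apply: measurable_bounded_integrable => //.
  by apply: (le_lt_trans (probability_le1 mu measurableT)); exact: ltry.
exact: continuous_borel_measurable.
Qed.

Lemma Rintegral_cst1 : \int[mu]_x (1 : R) = 1.
Proof.
rewrite Rintegral_cst// mul1r.
by have := congr1 fine (probability_setT mu); apply.
Qed.

Lemma Rintegral_invariant (phi : T -> T) (f : T -> R) :
  continuous phi ->
  (forall B : set (borelType T), measurable B -> mu (phi @^-1` B) = mu B) ->
  continuous f -> bounded_fun f ->
  \int[mu]_x f (phi x) = \int[mu]_x f x.
Proof.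
move=> cphi phiI cf bf.
have mphi : measurable_fun setT (phi : borelType T -> borelType T).
  apply: (@measurability _ _ (borelType T) (borelType T) setT phi
    (@open T) erefl).
  move=> _ [B Bo <-]; rewrite setTI; apply: sub_sigma_algebra.
  by move/continuousP: cphi; apply.
have iphi : mu.-integrable setT (EFin \o (f \o phi : borelType T -> R)).
  apply: continuous_borel_integrable; last exact: bounded_fun_comp.
  by move=> x; apply: continuous_comp; [exact: cphi | exact: cf].
have /measurable_EFinP mf := continuous_borel_measurable cf.
rewrite /Rintegral; congr fine.
have := integral_pushforward mphi mf iphi measurableT.
rewrite preimage_setT => <-.
by apply: eq_measure_integral => B mB _; exact: phiI.
Qed.

End BorelIntegral.

(** The invariant mean is the barycentre [f |-> \int m(f) dmu(m)] of an
    invariant probability measure [mu] on the space of means: the function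
    [m |-> m(f)] composed with the action of [h] is [m |-> m(f (h * _))]. *)
Lemma amenable_RUCB_mean (R : realType) (H : topGroupType) : amenable R H ->
  exists nu, is_mean (@RUCB R H) nu /\ left_invariant (@RUCB R H) nu.
Proof.
move=> /(_ _ (mean_action R H) (@meanSpace_compact R H)
  (@meanSpace_hausdorff R H))[mu [_ muI]].
have cE := @mean_eval_continuous R H; have bE := @mean_eval_bounded R H.
have iE f := continuous_borel_integrable mu (cE f) (bE f).
exists (fun f => \int[mu]_k mean_eval k f)%R; split.
  split=> [a f g Af Ag|f Af f0|].
  - have iaf : mu.-integrable setT (EFin \o (fun k => a * mean_eval k f)%R).
      apply: continuous_borel_integrable => [k|].
        by apply: continuousM; [exact: cst_continuous | exact: cE].
      have /bounded_funP[C fC] := bE f; apply/bounded_funP; exists (`|a| * C)%R.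
      by move=> k; rewrite normrM ler_wpM2l.
    rewrite -(RintegralZl _ _ (iE f))// -(RintegralD _ iaf (iE g))//.
    apply: eq_Rintegral => k _.
    by have [mL _ _] := mean_evalP k; rewrite mL.
  - by apply: Rintegral_ge0 => k _; have [_ mp _] := mean_evalP k; exact: mp.
  - under eq_Rintegral do rewrite (let: And3 _ _ m1 := mean_evalP _ in m1).
    exact: Rintegral_cst1.
move=> f h Af.
apply: (@Rintegral_invariant _ _ mu (mean_act h) ((@mean_eval R H)^~ f)) => //.
  exact: mean_act_continuousr.
by move=> B mB; exact: muI.
Qed.

(** * Transfer of means *)

Section UltrafilterRestriction.
Variables (R : realType) (G H : topGroupType) (psi : {multiplicative H -> G}).
Variables (tau : set_system G) (tauU : UltraFilter tau).
Local Open Scope ring_scope.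

#[local] Instance tau_proper : ProperFilter tau.
Proof. exact: ultra_proper. Qed.

Definition right_limit (f : G -> R) (h : H) : R :=
  lim (f (psi h * t)%g @[t --> tau]).

Lemma right_limit_cvg f h : bounded_fun f ->
  f (psi h * t)%g @[t --> tau] --> right_limit f h.
Proof.
move=> bf; apply: (ultra_cvg_lim tauU).
exact: (bounded_fun_comp (fun t => (psi h * t)%g) bf).
Qed.

(** With [f = g] this compares two points of [H]; with [f] a left translate of
    [g] it compares two translations of one function. *)
Lemma right_limit_dist (f g : G -> R) (x y : H) (e : R) :
  bounded_fun f -> bounded_fun g ->
  (\forall t \near tau, `|f (psi x * t)%g - g (psi y * t)%g| <= e) ->
  `|right_limit f x - right_limit g y| <= e.
Proof.
move=> bf bg fge.
have fg : `|f (psi x * t)%g - g (psi y * t)%g| @[t --> tau] -->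
    `|right_limit f x - right_limit g y|.
  by apply: cvg_norm; apply: cvgB; exact: right_limit_cvg.
rewrite -(cvg_lim (@Rhausdorff R) fg).
by apply: limr_le => //; exact: cvgP fg.
Qed.

Lemma right_limit_linear a (f g : G -> R) h : bounded_fun f -> bounded_fun g ->
  right_limit (fun x => a * f x + g x) h
    = a * right_limit f h + right_limit g h.
Proof.
move=> bf bg; apply: cvg_lim => //.
by apply: cvgD; [apply: cvgMr|]; exact: right_limit_cvg.
Qed.

(** Balancedness is what makes the continuity estimate uniform in [t]: a
    conjugate of [psi (x * y^-1)] by the arbitrary element [psi y * t] has to be
    small. *)
Lemma right_limit_RUCB (f : G -> R) : balanced psi -> LUCB f ->
  RUCB (right_limit f).
Proof.
move=> bal [bf uf]; split.
  have [C fC] := (bounded_funP f).1 bf; apply/bounded_funP; exists C => h.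
  have b0 : bounded_fun (fun _ : G => 0 : R).
    exact: (proj1 (RUCB_cst G (0 : R))).
  have l0 : right_limit (fun=> 0) h = 0 by exact: lim_cst.
  rewrite -[right_limit f h]subr0 -l0; apply: right_limit_dist => //.
  by apply: filterE => t; rewrite subr0.
move=> e /uf[U U1 fU]; have V1 := bal U U1.
exists (\bigcap_(g in [set: G]) psi @^-1` [set u ^ g | u in U]%g) => //.
move=> x y xy; apply: right_limit_dist => //; apply: filterE => t.
rewrite distrC; apply: fU.
have [u Uu] := xy (psi y * t)^-1%g I.
move/(congr1 (conjg^~ (psi y * t)%g)); rewrite conjgKV => uE.
suff -> : ((psi y * t)^-1 * (psi x * t) = u)%g by [].
rewrite uE conjgE; congr (_ * _)%g.
by rewrite mulgA -gmulfM mulgVK.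
Qed.

End UltrafilterRestriction.

(** The mean is [nu \o Phi], for [Phi] the limit along an ultrafilter finer than
    [attracted]; invariance under [g] reduces to that of [nu] under a [k] such
    that [psi k] agrees with [g] on a member of [A]. *)
Lemma skew_amenable_of_balanced (R : realType) (X : Type)
    (G : subgroup (Sym X)) (A : set_system X) (H : topGroupType)
    (psi : {multiplicative H -> set_type G}) : Filter A ->
  attractive_filter G A -> invariant_filter G A ->
  amenable R H -> balanced psi -> approximated A (hom_image psi) ->
  skew_amenable R (set_type G).
Proof.
move=> fA attA invA /amenable_RUCB_mean[nu [[nuL nu0 nu1] nuI]] bal apprA.
have AP := attracted_proper fA attA.
have [tau [tauU Atau]] := ultraFilterLemma AP.
have tauP := @ultra_proper _ _ tauU.
pose Phi : (set_type G -> R) -> H -> R := right_limit psi tau.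
have PhiR f : LUCB f -> RUCB (Phi f) by exact: right_limit_RUCB.
exists (nu \o Phi); split; first split.
- move=> a f g Af Ag /=.
  rewrite -nuL; [|exact: PhiR..]; congr nu; apply/funext => h.
  by apply: right_limit_linear; [exact: (proj1 Af) | exact: (proj1 Ag)].
- move=> f Af f0; apply: nu0; first exact: PhiR.
  move=> h; apply: limr_ge; last exact: filterE.
  have c := @right_limit_cvg R _ _ psi tau tauU f h (proj1 Af).
  by apply: cvgP; exact: c.
- rewrite /= -[RHS]nu1; congr nu; apply/funext => h.
  exact: lim_cst.
move=> f g Af /=.
have [bf uf] := Af.
have [_ [k _ <-] [B AB gk]] := apprA g.
rewrite -(nuI (Phi f) k (PhiR _ Af)); congr nu; apply/funext => h.
(* Both limits agree up to every [e], since [g s t] and [psi k s t] are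
   eventually [U]-close for [s = psi h]. *)
apply/eqP; rewrite -subr_eq0 -normr_le0; apply/ler_addgt0Pr => e e0.
rewrite add0r; have [U U1 fU] := uf e e0.
apply: (@right_limit_dist R _ _ psi tau tauU (fun x => f (g * x)) f) => //.
  exact: (bounded_fun_comp (fun x : set_type G => g * x) bf).
have := Atau _ (attracted_simulation invA AB gk (psi h) U1).
apply: filterS => t Ut; rewrite distrC; apply: fU.
by rewrite gmulfM (mulgA g).
Qed.

(** * The inclusion of a discrete subgroup *)

Section DiscreteSubgroup.
Variables (G : topGroupType) (K : subgroup G).

Definition discrete_incl : discrete_topology (set_type K) -> G := set_val.

Fact discrete_inclM : {morph discrete_incl : x y / x * y}.
Proof. by []. Qed.
HB.instance Definition _ := isMultiplicative.Build _ _ discrete_incl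
  discrete_inclM.

Lemma discrete_incl_balanced : balanced discrete_incl.
Proof.
move=> U U1.
apply: (@filterS _ (nbhs (1 : discrete_topology (set_type K))) _ [set 1]).
  by move=> _ -> g _ /=; exists 1; [exact: nbhs_singleton | rewrite conj1g].
exact: discrete_set1.
Qed.

End DiscreteSubgroup.

Lemma hom_image_discrete_incl (G : topGroupType) (K : subgroup G) :
  subgroup_set (hom_image (@discrete_incl G K)) = K.
Proof.
apply/seteqP; split=> [_ [k _ <-]|g Kg]; first exact/set_mem/valP.
by exists (exist _ g (mem_set Kg)).
Qed.

Theorem corollary7p14 (R : realType) (X : Type) (G : subgroup (Sym X))
    (A : set_system X) (filterA : Filter A)
    (attractA : attractive_filter G A) (invA : invariant_filter G A) :
  (forall H : subgroup G, approximated A H -> proximally_simulated H) /\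
  ((exists (H : topGroupType) (psi : {multiplicative H -> G}),
      [/\ amenable R H, balanced psi & approximated A (hom_image psi)]) ->
    skew_amenable R G) /\
  ((exists K : subgroup G, discretely_amenable R K /\ approximated A K) ->
    skew_amenable R G).
Proof.
split; last split.
- by move=> H; exact: approximated_proximally_simulated.
- move=> [H [psi [amH balH apprA]]].
  exact: skew_amenable_of_balanced amH balH apprA.
- move=> [K [amK apprA]].
  apply: (@skew_amenable_of_balanced R X G A _ (@discrete_incl (set_type G) K))
    amK (@discrete_incl_balanced (set_type G) K) _ => //.
  move=> g; have [h Kh hB] := apprA g; exists h => //.
  by rewrite /subgroup_mem hom_image_discrete_incl.
Qed.
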